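(* For every economy $\Gamma=(I,O,\succ_I,\{C_o\}_{o\in O})$, the refined exclusion core of $\Gamma$ is nonempty.
   Context: **Economies.** An economy is a tuple $\Gamma=(I,O,\succ_I,\{C_o\}_{o\in O})$, where $I$ is a finite set of agents, $O$ is a finite set of indivisible objects, each agent $i\in I$ demands at most one object and has a strict preference given by a linear order $\succ_i$ on $O\cup\{o^*\}$ ($o^*\notin O$ is a null object), and each object $o$ is owned by a nonempty set $C_o\subseteq I$ of agents. Write $a\succsim_i b$ if $a=b$ or $a\succ_i b$. A coalition is a nonempty subset of $I$; a sub-coalition of $C$ is a nonempty proper subset of $C$. The endowments of a set of agents $C$ are $\omega(C)=\{o\in O: C_o\subseteq C\}$. **Allocations.** An allocation is a map $\mu:I\to O\cup\{o^*\}$ such that each $o\in O$ is assigned to at most one agent ($|\mu^{-1}(o)|\le 1$); any number of agents may be assigned $o^*$. For a coalition $C$, $\mu(C)=\{\mu(i):i\in C\}$. **Self-enforcing.** A coalition $C$ is self-enforcing in an allocation $\sigma$ if $\sigma(C)\subseteq\omega(C)\cup\{o^*\}$; it is minimal self-enforcing in $\sigma$ if it is self-enforcing in $\sigma$ and no sub-coalition of $C$ is self-enforcing in $\sigma$. Let $C_{\sigma=\mu}=\{i\in C:\sigma(i)=\mu(i)\}$. **Controlled objects.** For a coalition $C$ and an allocation $\mu$, let $C^0=C$, $C^k=C^{k-1}\cup\{i\in I:\mu(i)\in\omega(C^{k-1})\}$ for $k\ge1$, and $\Omega(C|\omega,\mu)=\omega\big(\bigcup_{k=0}^\infty C^k\big)$.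 **Refined exclusion core.** An allocation $\mu$ is refined exclusion blocked by a coalition $C$ via another allocation $\sigma$ if: 1. $\sigma(i)\succsim_i\mu(i)$ for all $i\in C$, and $\sigma(j)\succ_j\mu(j)$ for some $j\in C$; 2. for every $j\in I$, $\mu(j)\succ_j\sigma(j)$ implies $\mu(j)\in\Omega(C|\omega,\mu)$; 3. if $C_{\sigma=\mu}\ne\emptyset$, then at least one of the following holds: (a) $C_{\sigma=\mu}$ is self-enforcing in $\sigma$ and, for every $j\in I$, $\mu(j)\succ_j\sigma(j)$ implies $\mu(j)\notin\Omega(C_{\sigma=\mu}|\omega,\mu)$; (b) $C$ is minimal self-enforcing in $\sigma$. The refined exclusion core is the set of allocations that are not refined exclusion blocked. *)

(* Defs.v *)
From mathcomp Require Import all_boot.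
From mathcomp Require Import boolp.
Set Implicit Arguments.
Unset Strict Implicit.
Unset Printing Implicit Defensive.

(* The null object is [None : option O]; [prefers i a b] reads "agent i
   strictly prefers a to b". *)
Record economy (I O : finType) : Type := Economy {
  prefers : I -> rel (option O);
  owners : O -> {set I};
  prefers_irr : forall i, irreflexive (prefers i);
  prefers_trans : forall i, transitive (prefers i);
  prefers_total : forall i a b, a != b -> prefers i a b || prefers i b a;
  owners_neq0 : forall o, owners o != set0
}.

Section Economy.
Variables (I O : finType) (G : economy I O).
Implicit Types (C D : {set I}) (mu sigma : {ffun I -> option O}).

Definition weakly_prefers (i : I) (a b : option O) : bool :=
  (a == b) || prefers G i a b.

Definition endowment C : {set O} := [set o | owners G o \subset C].

Definition is_allocation mu : Prop :=
  forall o : O, #|[set i | mu i == Some o]| <= 1.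

Definition self_enforcing sigma C : Prop :=
  sigma @: C \subset None |: (Some @: endowment C).

Definition minimal_self_enforcing sigma C : Prop :=
  self_enforcing sigma C /\
  forall D, D != set0 -> D \proper C -> ~ self_enforcing sigma D.

Definition agree C sigma mu : {set I} := [set i in C | sigma i == mu i].

Fixpoint control_step mu C (k : nat) : {set I} :=
  if k is k'.+1 then
    control_step mu C k' :|:
      [set i | mu i \in Some @: endowment (control_step mu C k')]
  else C.

Definition control_closure mu C : {set I} :=
  [set i | `[< exists k : nat, i \in control_step mu C k >]].

Definition controlled mu C : {set O} := endowment (control_closure mu C).

(* Condition 1 already forces sigma to differ from mu. *)
Definition refined_exclusion_blocked_via mu C sigma : Prop :=
  [/\ (forall i, i \in C -> weakly_prefers i (sigma i) (mu i)) /\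
        (exists2 j, j \in C & prefers G j (sigma j) (mu j)),
      (forall j, prefers G j (mu j) (sigma j) ->
         mu j \in Some @: controlled mu C)
    & agree C sigma mu != set0 ->
        (self_enforcing sigma (agree C sigma mu) /\
         forall j, prefers G j (mu j) (sigma j) ->
           mu j \notin Some @: controlled mu (agree C sigma mu))
        \/ minimal_self_enforcing sigma C].

Definition refined_exclusion_blocked mu : Prop :=
  exists C sigma, [/\ C != set0, is_allocation sigma
                    & refined_exclusion_blocked_via mu C sigma].

Definition refined_exclusion_core mu : Prop :=
  is_allocation mu /\ ~ refined_exclusion_blocked mu.

End Economy.

(* Main.v *)
(* Run top trading cycles, where each object points to a remaining owner if there
   is one, otherwise to a remaining agent reachable from its owners along
   departed agents' assignments, otherwise to whoever points to it.
   If a blocking coalition C is minimal self-enforcing in sigma, an induction on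
   the rounds shows that every cycle meeting C stays in C and implements sigma,
   so nobody in C gains.  If instead A = C_{sigma=mu} is empty or satisfies (a),
   the first agent to gain gets an object that a hurt agent j took in an earlier
   round; j is controlled by C but not by A, and such an agent cannot leave
   before some member of C \ A, all of whom gain: a contradiction. *)
Require Import Defs.
From mathcomp Require Import all_boot.
From mathcomp Require Import boolp.
Set Implicit Arguments.
Unset Strict Implicit.
Unset Printing Implicit Defensive.

(** * Orbits in a finite type and undominated elements *)

Lemma iter_orbit_closed (T : Type) (P : T -> Prop) (f : T -> T) (x : T) m :
  (forall y, P y -> P (f y)) -> P x -> P (iter m f x).
Proof. by move=> Pf Px; elim: m => //= m; apply: Pf. Qed.

Lemma exists_periodic (T : finType) (f : T -> T) (x : T) :
  exists m d, iter d.+1 f (iter m f x) = iter m f x.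
Proof.
have /loopingP/(_ (order f x))/trajectP[m lt_m eq_m] := looping_order f x.
(* Step [order f x] of the orbit repeats the earlier step [m]; their gap is positive, and the
   predecessor fits it to the form [d.+1]. *)
exists m, (order f x - m).-1.
by rewrite prednK ?subn_gt0 // -iterD subnK // ltnW.
Qed.

Lemma iter_periodic (T : Type) (f : T -> T) (x : T) d u m :
  iter d.+1 f x = x -> iter (u * d.+1) f (iter m f x) = iter m f x.
Proof.
by move=> fx; elim: u => // u IHu; rewrite mulSn iterD IHu -iterD addnC iterD fx.
Qed.

(** An element with the most elements below it works: anything above it would have strictly more
    below. *)
Lemma exists_undominated (T : finType) (r : rel T) (A : {set T}) (x0 : T) :
  irreflexive r -> transitive r -> x0 \in A ->
  exists2 x, x \in A & forall y, y \in A -> ~~ r y x.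
Proof.
move=> r_irr r_tr Ax0.
case: (@arg_maxnP _ x0 (mem A) (fun x => #|[set y | r x y]|) Ax0) => x Ax max_x.
exists x => // y Ay; apply/negP=> ryx.
have := max_x y Ay; rewrite /= leqNgt => /negP; apply; apply: proper_card.
apply/properP; split; last by exists x; rewrite !inE ?r_irr.
by apply/subsetP=> z; rewrite !inE; apply: r_tr.
Qed.

Section Trading.
Variables (I O : finType) (G : economy I O).
Implicit Types (A C D R Q : {set I}) (mu : I -> option O) (t : I -> nat) (p : I -> I).

(** * Entitlement and the pointing of objects *)

Definition entitled D (a : option O) : bool :=
  a \in None |: (Some @: endowment G D).

Lemma entitled_None D : entitled D None.
Proof. by rewrite /entitled !inE. Qed.

Lemma entitled_Some D o : entitled D (Some o) = (owners G o \subset D).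
Proof. by rewrite /entitled !inE /= mem_imset ?inE // => ? ? []. Qed.

Lemma entitledI D C a : entitled D a -> entitled C a -> entitled (D :&: C) a.
Proof. by case: a => [o|]; rewrite ?entitled_None ?entitled_Some // subsetI => -> ->. Qed.

Lemma entitledS D C a : D \subset C -> entitled D a -> entitled C a.
Proof.
by case: a => [o|]; rewrite ?entitled_None ?entitled_Some // => DC /subset_trans; apply.
Qed.

Lemma self_enforcingP (sigma : {ffun I -> option O}) D :
  self_enforcing G sigma D <-> (forall i, i \in D -> entitled D (sigma i)).
Proof.
split=> [/subsetP se i iD|se]; first by apply: se; apply: imset_f.
by apply/subsetP=> _ /imsetP[i iD ->]; apply: se.
Qed.

(* [heir mu R o u]: after the agents of [R] have left with their assignments
   under [mu], object [o] points to the agent [k] if [u = Some k], and is up for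
   grabs if [u = None].  The middle clause says that [k] is reached from the
   owners of [o] by following assigned objects to their owners. *)
Definition heir mu R (o : O) (u : option I) : Prop :=
  if u is Some k then
    [/\ k \notin R,
        forall D, owners G o \subset D ->
          (forall r, r \in D -> r \in R -> entitled D (mu r)) -> k \in D
      & ~~ (owners G o \subset R) -> k \in owners G o]
  else exists D, [/\ owners G o \subset D, D \subset R
                   & forall r, r \in D -> entitled D (mu r)].

Lemma heir_exists mu R o : exists u, heir mu R o u.
Proof.
have [sR|/subsetPn[w wo wR]] := boolP (owners G o \subset R); last first.
  exists (Some w); split=> // D /subsetP oD _; exact: oD.
pose cl D := [&& owners G o \subset D
  & [forall r, (r \in D) ==> (r \in R) ==> entitled D (mu r)]].
have clP D : cl D <-> owners G o \subset D /\
    (forall r, r \in D -> r \in R -> entitled D (mu r)).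
  rewrite /cl; split=> [/andP[-> /forallP h]|[-> h]].
    by split=> // r rD rR; have := h r; rewrite rD rR.
  by apply/forallP=> r; apply/implyP=> rD; apply/implyP=> rR; apply: h.
(* The least set containing the owners and closed under the departed agents' claims. Any member
   outside [R] can serve as heir; if there is none, [D0] itself witnesses the case [None]. *)
pose D0 := \bigcap_(D | cl D) D.
have clD0 : cl D0.
  rewrite /D0; elim/big_rec: _ => [|D E /clP[oD hD] /clP[oE hE]].
    by apply/clP; split=> [|r _ _]; rewrite ?subsetT //; case: (mu r) => [x|];
      rewrite ?entitled_None ?entitled_Some ?subsetT.
  apply/clP; split=> [|r /setIP[rD rE] rR]; first by rewrite subsetI oD.
  by apply: entitledI; [apply: hD | apply: hE].
have /clP[oD0 hD0] := clD0.
have [D0R|/subsetPn[w wD0 wR]] := boolP (D0 \subset R).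
  exists None, D0; split=> // r rD0; apply: hD0 => //; exact: (subsetP D0R).
exists (Some w); split=> //; last by rewrite sR.
move=> D oD hD; have /bigcapP/(_ D) := wD0; apply; exact/clP.
Qed.

Lemma heir_congr mu mu' R o u :
  (forall r, r \in R -> mu r = mu' r) -> heir mu R o u -> heir mu' R o u.
Proof.
move=> eq_mu; case: u => [k [kR kD ko]|[D [oD DR hD]]].
  split=> // D oD hD; apply: kD => // r rD rR; rewrite eq_mu //; exact: hD.
exists D; split=> // r rD; rewrite -eq_mu ?hD //; exact: (subsetP DR).
Qed.

(** * Top trading cycles *)

Definition departed t (n : nat) : {set I} := [set i | t i < n].

(* The state of top trading cycles before round [n]: the agents [i] with
   [t i < n] have left, agent [i] in round [t i] with [mu i], by following the
   cycle of [p]. *)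
Definition trading_history mu t p (n : nat) : Prop :=
  [/\ forall i j o, t i < n -> t j < n -> mu i = Some o -> mu j = Some o -> i = j,
      forall i, t i < n -> ~~ prefers G i None (mu i) /\
        (forall o, prefers G i (Some o) (mu i) ->
           exists2 j, t j < t i & mu j = Some o),
      forall i, t i < n -> t (p i) = t i,
      forall i j, t i < n -> t j = t i -> exists m, j = iter m p i
    & forall i, t i < n -> if mu i is Some o then
          exists2 u, heir mu (departed t (t i)) o u & p i = odflt i u
        else p i = i].

(** Each agent [i] picks a best untaken object [f i] and points to [g i], that object's heir, or
    itself if there is none. The cycle [Q] of [g] reached from [x0] leaves in round [n]. *)
Lemma trading_round mu t p n :
  trading_history mu t p n -> (exists i, n <= t i) ->
  exists mu' t' p', trading_history mu' t' p' n.+1 /\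
    #|[set i | n < t' i]| < #|[set i | n <= t i]|.
Proof.
move=> [inj fav pt conn hp] [x0 nx0].
pose R := departed t n.
pose A := None |: (Some @: [set o | [forall i in R, mu i != Some o]]).
have AP o : (Some o \in A) = [forall i in R, mu i != Some o].
  by rewrite !inE /= mem_imset ?inE // => ? ? [].
have /choice[f fP] : forall i, exists a, a \in A /\ forall b, b \in A -> ~~ prefers G i b a.
  move=> i; have [|||a aA amax] := @exists_undominated _ (prefers G i) A None.
  - exact: prefers_irr.
  - exact: prefers_trans.
  - by rewrite !inE.
  by exists a.
have /choice[h hP] := heir_exists mu R.
pose g i := if f i is Some o then odflt i (h o) else i.
have gR i : n <= t i -> n <= t (g i).
  rewrite /g; case: (f i) => [o|] //; have := hP o; case: (h o) => [k|] //=.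
  by case; rewrite inE -leqNgt.
have [m [d gy]] := exists_periodic g x0; set y := iter m g x0 in gy.
have ny : n <= t y by apply: iter_orbit_closed gR nx0.
pose Q := [set i | `[< exists k, i = iter k g y >]].
have QP i : reflect (exists k, i = iter k g y) (i \in Q) by rewrite inE; apply: asboolP.
have yQ : y \in Q by apply/QP; exists 0.
have Qg i : i \in Q -> g i \in Q.
  by move=> /QP[k ->]; apply/QP; exists k.+1.
have Qn i : i \in Q -> n <= t i.
  by move=> /QP[k ->]; apply: iter_orbit_closed gR ny.
have Qper i : i \in Q -> iter d.+1 g i = i.
  by move=> /QP[k ->]; have := @iter_periodic _ g y d 1 k gy; rewrite mul1n.
have Qconn i j : i \in Q -> j \in Q -> exists k, j = iter k g i.
  (* From step [a] of the orbit, [a * d] more steps make [a * d.+1] in total, which is back at [y];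
     then [b] steps lead to [j]. *)
  move=> /QP[a ->] /QP[b ->]; exists (b + a * d); rewrite -iterD -addnA iterD.
  by congr (iter b g _); rewrite addnC -mulnS (@iter_periodic _ g y d a 0 gy).
have Qinj i j o : i \in Q -> j \in Q -> f i = Some o -> f j = Some o -> i = j.
  (* If [o] has an heir, [i] and [j] have the same image under [g], which is injective on its cycle.
     Otherwise [i] points to itself and [Q] is a singleton. *)
  move=> iQ jQ fi fj; have := hP o; case ho: (h o) => [k|] _.
    have eg : g i = g j by rewrite /g fi fj ho.
    by rewrite -(Qper i iQ) -(Qper j jQ) !iterSr eg.
  have gi : g i = i by rewrite /g fi ho.
  have [k ->] := Qconn i j iQ jQ; by elim: k => //= k <-.
have QnR i : i \in Q -> (t i < n) = false by move=> /Qn; rewrite leqNgt => /negbTE.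
pose mu' i := if i \in Q then f i else mu i.
pose p' i := if i \in Q then g i else p i.
(* The value [n.+1] keeps agents outside [Q] among those still present after round [n]. *)
pose t' i := if t i < n then t i else if i \in Q then n else n.+1.
have muR i : t i < n -> mu' i = mu i.
  by rewrite /mu'; case: ifP => // /QnR ->.
have pR i : t i < n -> p' i = p i.
  by rewrite /p'; case: ifP => // /QnR ->.
have tR i : t i < n -> t' i = t i by rewrite /t' => ->.
have tQ i : i \in Q -> t' i = n by rewrite /t' => iQ; rewrite QnR // iQ.
have tlt i k : k <= n -> (t' i < k) = (t i < k).
  rewrite /t' => kn; case: (ltnP (t i) n) => // nt.
  rewrite [RHS]ltnNge (leq_trans kn nt) /=.
  by case: ifP => _; apply/negbTE; rewrite -leqNgt // ltnW.
have depE k : k <= n -> departed t' k = departed t k.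
  by move=> kn; apply/setP=> i; rewrite !inE tlt.
have split' i : t' i < n.+1 -> t i < n \/ i \in Q.
  by rewrite /t'; case: (t i < n); [left|case: (i \in Q); [right|rewrite ltnn]].
have avail i j o : t i < n -> f j = Some o -> mu i <> Some o.
  move=> it fj mi; have [] := fP j; rewrite fj AP => /forall_inP/(_ i).
  by rewrite inE it mi eqxx => /(_ isT).
exists mu', t', p'; split; last first.
  apply: proper_card; apply/properP; split; last first.
    by exists y; rewrite inE ?tQ ?ltnn.
  by apply/subsetP=> i; rewrite !inE /t'; case: (ltnP (t i) n) => // lt /ltnW; rewrite leqNgt lt.
split.
- move=> i j o /split'[it|iQ] /split'[jt|jQ].
  + by rewrite !muR //; apply: inj.
  + rewrite muR // {1}/mu' jQ => mi fj; by case: (avail _ _ _ it fj).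
  + rewrite (muR j) // {1}/mu' iQ => fi mj; by case: (avail _ _ _ jt fi).
  + rewrite /mu' iQ jQ; exact: Qinj.
- move=> i /split'[it|iQ].
    rewrite muR // tR //; have [f1 f2] := fav i it; split=> // o /f2[j jt mj].
    exists j; first by rewrite tlt // ltnW.
    by rewrite muR //; apply: ltn_trans it.
  rewrite tQ // /mu' iQ; have [_ fi] := fP i.
  split=> [|o po]; first by apply: fi; rewrite !inE.
  have /negP := contraL (fi (Some o)) po.
  rewrite AP => /negP/forall_inPn[j jR /negPn/eqP mj].
  have jt : t j < n by move: jR; rewrite inE.
  by exists j; [rewrite tR | case: ifP => // /QnR; rewrite jt].
- move=> i /split'[it|iQ]; last by rewrite /p' iQ !tQ ?Qg.
  by rewrite pR // !tR ?pt.
- move=> i j /split'[it|iQ].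
    rewrite (tR i) // => tj; have jt : t j < n by rewrite -(tlt j n) // tj.
    rewrite tR // in tj; have [k ->] := conn i j it tj; exists k.
    have : t (iter k p i) < n /\ iter k p i = iter k p' i; last by case.
    elim: k => //= k [IHt IHe]; rewrite -IHe pR // pt //.
  rewrite (tQ i) // => tj.
  have [jt|jQ] : t j < n \/ j \in Q by apply: split'; rewrite tj.
    by have := jt; rewrite -(tR j jt) tj ltnn.
  have [k ->] := Qconn i j iQ jQ; exists k; elim: k => //= k <-.
  have : iter k g i \in Q by elim: (k) => //= k' /Qg.
  by rewrite /p' => ->.
move=> i /split'[it|iQ].
  have := hp i it; rewrite muR // pR // tR //; case: (mu i) => [o|] // [u hu pi].
  exists u => //; rewrite depE ?(ltnW it) //; apply: heir_congr hu => r.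
  by rewrite inE => rt; rewrite muR //; apply: ltn_trans it.
rewrite tQ // depE // /mu' /p' iQ /g; case: (f i) => [o|] //.
exists (h o) => //; apply: heir_congr (hP o) => r; rewrite inE => rt.
by case: ifP => // /QnR; rewrite rt.
Qed.

Lemma trading_history_exists :
  exists mu t p n, trading_history mu t p n /\ forall i, t i < n.
Proof.
suff H k : forall mu t p n, trading_history mu t p n -> #|[set i | n <= t i]| <= k ->
    exists mu t p n, trading_history mu t p n /\ forall i, t i < n.
  (* Before round 0 nobody has left, so the initial data are arbitrary. *)
  by apply: (H _ (fun=> None) (fun=> 0) id 0) => //; split.
elim: k => [|k IHk] mu t p n hist.
  rewrite leqn0 cards_eq0 => /eqP e; exists mu, t, p, n; split=> // i.
  by have := in_set0 i; rewrite -e inE => /negbT; rewrite -ltnNge.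
move=> le_k; have [ex|/forallNP nex] := pselect (exists i, n <= t i); last first.
  by exists mu, t, p, n; split=> // i; have := nex i; rewrite ltnNge => /negP.
have [mu' [t' [p' [hist' lt]]]] := trading_round hist ex.
by apply: (IHk _ _ _ _ hist'); rewrite -ltnS (leq_trans lt).
Qed.

(** * Control closures *)

Lemma control_step_mono (mu : {ffun I -> option O}) C k l :
  k <= l -> control_step G mu C k \subset control_step G mu C l.
Proof.
by move=> /subnK <-; elim: (l - k) => //= m /subset_trans; apply; apply: subsetUl.
Qed.

Lemma control_stepP (mu : {ffun I -> option O}) C k i :
  i \in control_step G mu C k.+1 ->
  i \in control_step G mu C k \/
  exists2 o, mu i = Some o & owners G o \subset control_step G mu C k.
Proof.
rewrite /= !inE => /orP[|/imsetP[o]]; first by left.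
by rewrite inE => oC mi; right; exists o.
Qed.

Lemma control_closureP (mu : {ffun I -> option O}) C i :
  reflect (exists k, i \in control_step G mu C k) (i \in control_closure G mu C).
Proof. by rewrite inE; apply: asboolP. Qed.

Lemma control_step_closure (mu : {ffun I -> option O}) C k :
  control_step G mu C k \subset control_closure G mu C.
Proof. by apply/subsetP=> i ik; apply/control_closureP; exists k. Qed.

(** By finiteness a single step reaches the whole closure, so objects owned within the closure are
    already owned within one step. *)
Lemma control_closure_step (mu : {ffun I -> option O}) C :
  exists k, control_closure G mu C = control_step G mu C k.
Proof.
have /choice[f fP] : forall i, exists k,
    i \in control_closure G mu C -> i \in control_step G mu C k.
  move=> i; case: (control_closureP mu C i) => [[k ik]|_]; first by exists k.
  by exists 0.
exists (\max_i f i); apply/eqP; rewrite eqEsubset control_step_closure andbT.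
apply/subsetP=> i /fP; apply/subsetP/control_step_mono; exact: leq_bigmax.
Qed.

Lemma control_closure0 (mu : {ffun I -> option O}) :
  control_closure G mu set0 = set0.
Proof.
have [k ->] := control_closure_step mu set0; elim: k => //= k ->.
rewrite set0U; apply/setP=> i; rewrite !inE; apply/negbTE/imsetP=> -[o].
by rewrite inE subset0 (negbTE (owners_neq0 _ _)).
Qed.

Lemma mem_control_closure (mu : {ffun I -> option O}) C i o :
  mu i = Some o -> owners G o \subset control_closure G mu C ->
  i \in control_closure G mu C.
Proof.
move=> mi; have [k Ek] := control_closure_step mu C; rewrite {1}Ek => oC.
apply: (subsetP (control_step_closure mu C k.+1)).
by rewrite /= !inE mi mem_imset ?inE ?oC ?orbT // => ? ? [].
Qed.

(** * Properties of a completed run *)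

Section Completed.
Variables (mu : {ffun I -> option O}) (t : I -> nat) (p : I -> I) (n : nat).
Hypothesis hist : trading_history mu t p n.
Hypothesis all_left : forall i, t i < n.

(** The agents of one round form a single cycle of [p]. *)
Lemma same_round (X : {pred I}) i j :
  (forall k, t k = t i -> k \in X -> p k \in X) -> i \in X -> t j = t i -> j \in X.
Proof.
have [_ _ pt conn _] := hist.
move=> Xp iX /(conn i j (all_left i))[m ->].
have : t (iter m p i) = t i /\ iter m p i \in X; last by case.
by elim: m => //= m [IHt IHX]; rewrite pt // Xp.
Qed.

(** The confinement principle: an heir of [mu i] lies in every set that contains the owners and is
    closed under the claims of earlier leavers. *)
Lemma next_in D i : i \in D -> entitled D (mu i) ->
  (forall r, r \in D -> t r < t i -> entitled D (mu r)) -> p i \in D.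
Proof.
have [_ _ _ _ /(_ i (all_left i))] := hist.
case: (mu i) => [o|] => [[[k|] hu ->]|->] iD //=.
rewrite entitled_Some => oD hD; case: hu => _ + _; apply=> // r rD.
by rewrite inE; apply: hD.
Qed.

Lemma minimal_self_enforcing_agree (sigma : {ffun I -> option O}) C :
  is_allocation sigma -> minimal_self_enforcing G sigma C ->
  (forall i, i \in C -> weakly_prefers G i (sigma i) (mu i)) ->
  forall i, i \in C -> sigma i = mu i.
Proof.
have [_ fav pt _ hp] := hist.
move=> sigma_inj [/self_enforcingP se minC] wp i.
have [m] := ubnP (t i); elim: m i => // m IHm i lt_m iC.
have {}IHm r : r \in C -> t r < t i -> sigma r = mu r.
  by move=> rC rt; apply: IHm => //; apply: leq_trans rt _.
have /orP[/eqP //|pi] := wp i iC.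
case si : (sigma i) pi => [o|] pi; last by have [/negP] := fav i (all_left i).
have [_ /(_ o pi)[j jt mj]] := fav i (all_left i).
have oC : owners G o \subset C by have := se i iC; rewrite si entitled_Some.
have entC r : r \in C -> t r < t i -> entitled C (mu r).
  by move=> rC rt; rewrite -IHm ?se.
have pjC : p j \in C.
  have := hp j (all_left j); rewrite mj => -[[k|] hu ->] /=.
    case: hu => _ + _; apply=> // r rC; rewrite inE => rt.
    exact: entC (ltn_trans rt jt).
  (* Had [o] no heir, [D :&: C] would be a smaller self-enforcing set: it contains the owners of
     [o], and it misses [i] because [D] left before [j] did. *)
  have [D [oD /subsetP Dt hD]] := hu; case: (minC (D :&: C)).
  - have /set0Pn[w wo] := owners_neq0 G o; apply/set0Pn; exists w.
    by rewrite inE (subsetP oD) ?(subsetP oC).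
  - apply/properP; split; first exact: subsetIr.
    exists i => //; rewrite inE; apply/negP=> /andP[/Dt + _].
    by rewrite inE ltnNge ltnW.
  apply/self_enforcingP=> r /setIP[rD rC].
  have rt : t r < t i by apply: ltn_trans jt; have := Dt r rD; rewrite inE.
  by apply: entitledI; [rewrite IHm ?hD | apply: se].
(* The cycle of [j] meets [C] at [p j] and is confined to [C], since its round precedes that of
   [i]. *)
have jC : j \in C.
  apply: (same_round (i := p j)) pjC _; last by rewrite pt.
  rewrite pt // => k kt kC; apply: next_in => // [|r rC rt].
    by apply: entC; rewrite ?kt.
  by apply: entC => //; apply: ltn_trans rt _; rewrite kt.
have sj : sigma j = Some o by rewrite IHm.
have /card_le1_eqP/(_ i j) eij := sigma_inj o.
by move: jt; rewrite eij ?ltnn // inE ?si ?sj.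
Qed.

Lemma control_closure_self_enforcing C :
  (forall i, i \in C -> entitled C (mu i)) ->
  forall i, i \in control_closure G mu C ->
    entitled (control_closure G mu C) (mu i).
Proof.
move=> se i /control_closureP[k]; elim: k i => [|k IHk] i.
  by move=> /se; apply: entitledS; apply: (control_step_closure mu C 0).
move=> /control_stepP[/IHk //|[o -> oC]]; rewrite entitled_Some.
exact: subset_trans oC (control_step_closure _ _ _).
Qed.

(* Self-enforcement of [A] confines every cycle through its control closure to
   that closure, so a cycle of other controlled agents cannot use objects of
   the closure of [A]; following it descends the control steps of [C] down to
   [C :\: A]. *)
Lemma controlled_after C A i :
  (forall r, r \in A -> entitled A (mu r)) ->
  i \in control_closure G mu C -> i \notin control_closure G mu A ->
  exists2 s, s \in C :\: A & t s <= t i.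
Proof.
have [_ _ pt _ hp] := hist.
move=> /control_closure_self_enforcing; set CA := control_closure G mu A => se iC iA.
have [k /andP[kC kA] kmin] := @arg_minnP _ i
  (fun r => (r \in control_closure G mu C) && (r \notin CA)) t (introT andP (conj iC iA)).
suff [s sCA ts] : exists2 s, s \in C :\: A & t s = t k.
  by exists s; rewrite // ts kmin ?iC.
have notA r : t r = t k -> r \notin CA.
  move=> tr; apply: contra kA => rA; apply: (same_round (i := r)) => // l _ lA.
  by apply: next_in => //; [apply: se | move=> ? /se].
have /control_closureP[m] := kC.
suff H r : r \in control_step G mu C m -> t r = t k ->
    exists2 s, s \in C :\: A & t s = t k by move=> km; apply: H km _.
elim: m r => [|m IHm] r rm tr.
  exists r => //; rewrite !inE rm andbT; apply: contra (notA r tr) => rA.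
  exact: (subsetP (control_step_closure mu A 0)).
have [rm'|[o mr om]] := control_stepP rm; first exact: IHm rm' tr.
(* By minimality of [t k], the owner [w] is still present in this round, so [o] points to a
   remaining owner, who lies one control step lower. *)
have /subsetPn[w wo wA] : ~~ (owners G o \subset CA).
  by apply: contra (notA r tr); apply: mem_control_closure.
have tw : t k <= t w.
  by apply: kmin; rewrite wA (subsetP (control_step_closure mu C m)) // (subsetP om).
have := hp r (all_left r); rewrite mr => -[[l|] hu pr].
  apply: (IHm (p r)); last by rewrite pt.
  rewrite pr /=; apply: (subsetP om); case: hu => _ _; apply.
  by apply/subsetPn; exists w => //; rewrite inE tr -leqNgt.
have [D [/subsetP/(_ w wo) wD /subsetP/(_ w wD)]] := hu.
by rewrite inE tr ltnNge tw.
Qed.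

Lemma no_gain_if_agree_self_enforcing (sigma : {ffun I -> option O}) C :
  is_allocation sigma ->
  (forall i, i \in C -> weakly_prefers G i (sigma i) (mu i)) ->
  (forall r, r \in agree C sigma mu -> entitled (agree C sigma mu) (mu r)) ->
  (forall j, prefers G j (mu j) (sigma j) -> mu j \in Some @: controlled G mu C) ->
  (forall j, prefers G j (mu j) (sigma j) ->
     mu j \notin Some @: controlled G mu (agree C sigma mu)) ->
  forall i, ~~ prefers G i (sigma i) (mu i).
Proof.
have [_ fav _ _ _] := hist.
move=> sigma_inj wp se hC hA i0; apply/negP=> i0P.
have [i iP imin] := @arg_minnP _ i0 (fun i => prefers G i (sigma i) (mu i)) t i0P.
case si : (sigma i) iP => [o|] iP; last by have [/negP] := fav i (all_left i).
have [_ /(_ o iP)[j jt mj]] := fav i (all_left i).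
(* Since [sigma] gives [o] to [i], agent [j] does not keep it; leaving before the first gainer, [j]
   can only lose. *)
have sj : mu j != sigma j.
  apply/eqP=> e; have /card_le1_eqP/(_ i j) eij := sigma_inj o.
  by move: jt; rewrite eij ?ltnn // inE ?si -?e ?mj.
have worse : prefers G j (mu j) (sigma j).
  have /orP[//|/imin] := prefers_total G j sj.
  by rewrite leqNgt jt.
have := hC j worse; have := hA j worse.
rewrite mj !mem_imset ?[_ \in controlled _ _ _]inE; try by move=> ? ? [].
move=> oA oC.
have jC : j \in control_closure G mu C by apply: mem_control_closure oC.
have jA : j \notin control_closure G mu (agree C sigma mu).
  apply: contra oA => /(control_closure_self_enforcing se).
  by rewrite mj entitled_Some.
have [s /setDP[sC sA] ts] := controlled_after se jC jA.
have /orP[e|/imin] := wp s sC; first by move: sA; rewrite inE sC e.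
by rewrite leqNgt (leq_ltn_trans ts).
Qed.

End Completed.
End Trading.

Theorem theorem2 (I O : finType) (G : economy I O) :
  exists mu : {ffun I -> option O}, refined_exclusion_core G mu.
Proof.
have [mu0 [t [p [n [hist0 left]]]]] := trading_history_exists G.
pose mu := [ffun i => mu0 i].
have hist : trading_history G mu t p n.
  by have -> : mu = mu0 :> (I -> option O) by apply/funext=> i; rewrite ffunE.
exists mu; split.
  have [inj _ _ _ _] := hist.
  move=> o; apply/card_le1_eqP=> i j; rewrite !inE => /eqP mi /eqP mj.
  exact: (inj j i o).
move=> [C [sigma [_ sigma_inj [[wp [j jC jP]] hC hA]]]].
have [Am|/hA[[/self_enforcingP se {}hA]|mse]] := eqVneq (agree C sigma mu) set0.
(* The empty set is vacuously self-enforcing and controls nothing, as every object has an owner. *)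
- have := no_gain_if_agree_self_enforcing hist left sigma_inj wp.
  rewrite Am => /(_ _ hC) H; apply/negP: jP; apply: H => [r|k _]; first by rewrite inE.
  apply/imsetP=> -[o]; rewrite inE control_closure0 subset0.
  by rewrite (negbTE (owners_neq0 _ _)).
- apply/negP: jP; apply: (no_gain_if_agree_self_enforcing hist left sigma_inj wp) => //.
  move=> r rA; have := se r rA.
  by move: (rA); rewrite {1}inE => /andP[_ /eqP ->].
have := jP.
by rewrite (minimal_self_enforcing_agree hist left sigma_inj mse wp) // prefers_irr.
Qed.
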